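(* Let $G=(N,\mathcal N,\Sigma,S,R)$ be an MCFTG. Then $L(G)=\{t\in T_\Sigma\mid S\otimes\varepsilon\Rightarrow_G^* t\}$, where $\Rightarrow_G^*$ is the reflexive, transitive closure of the derivation step relation $\Rightarrow_G$ of $G$ on $T_{(N\times\mathbb N^* )\cup\Sigma}$.
   Context: **Sequences and trees.** $\mathbb N=\{1,2,\dots\}$, $\mathbb N_0=\mathbb N\cup\{0\}$; $\varepsilon$ is the empty sequence. $A^*$ (resp. $A^+$) is the set of finite (resp. nonempty finite) sequences over $A$; a sequence of length 1 is identified with its element; juxtaposition is concatenation; $\mathrm{occ}(w)$ is the set of elements occurring in the sequence $w$; $w$ is repetition-free if no element occurs twice in it. A ranked alphabet is a (possibly infinite) set $\Sigma$ with a rank map $\mathrm{rk}\colon\Sigma\to\mathbb N_0$ (applied elementwise to sequences); $\Sigma^{(k)}$ is the set of symbols of rank $k$. $T_\Sigma$ is the set of trees over $\Sigma$: the smallest set of strings over $\Sigma$ containing $\sigma t_1\cdots t_k$ (also written $\sigma(t_1,\dots,t_k)$) for all $\sigma\in\Sigma^{(k)}$ and $t_i\in T_\Sigma$. A forest is a finite sequence of trees. $X=\{x_1,x_2,\dots\}$ is a set of variables (of rank 0, disjoint from other alphabets), $X_k=\{x_1,\dots,x_k\}$. A pattern of rank $k$ over $\Sigma$ is a tree over $\Sigma\cup X_k$ in which each of $x_1,\dots,x_k$ occurs exactly once; $P_\Sigma(X_k)$ is the set of these and $P_\Sigma(X)=\bigcup_k P_\Sigma(X_k)$. $\mathrm{in}(\sigma)=\sigma(x_1,\dots,x_k)$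 for $\sigma$ of rank $k$, applied elementwise to sequences. For a forest $t$, $\mathrm{occ}_\Omega(t)$ is the set of symbols of $\Omega$ occurring in $t$; $t$ is uniquely $\Omega$-labeled if each symbol of $\Omega$ occurs at most once in $t$. **Substitution.** For a repetition-free sequence of symbols $\sigma=(\sigma_1,\dots,\sigma_n)$ and patterns $u=(u_1,\dots,u_n)$ with $\mathrm{rk}(u)=\mathrm{rk}(\sigma)$, $t[\sigma\gets u]$ is obtained from $t$ by replacing, recursively, each subtree $\sigma_i(s_1,\dots,s_k)$ by $u_i$ in which $x_j$ is replaced by the transformed $s_j$ (componentwise on forests). For $\mathcal L=\{B_1,\dots,B_k\}$ with $B_1\cdots B_k$ repetition-free and forests $f(B_i)$ with $\mathrm{rk}(f(B_i))=\mathrm{rk}(B_i)$, $t[B\gets f(B)\mid B\in\mathcal L]$ means $t[B_1\cdots B_k\gets f(B_1)\cdots f(B_k)]$. **MCFTG.** A multiple context-free tree grammar (MCFTG) is $G=(N,\mathcal N,\Sigma,S,R)$ where $N$ is a finite ranked alphabet of nonterminals; $\mathcal N\subseteq N^+$ is a finite set of repetition-free sequences (big nonterminals) with $\mathrm{occ}(A)\ne\mathrm{occ}(A')$ for distinct $A,A'\in\mathcal N$; $\Sigma$ is a finite ranked alphabet of terminals, disjoint from $N$, containing a symbol of rank at least 1; $S\in\mathcal N\cap N^{(0)}$ is the initial nonterminal; $R$ is a finite set of rules $A\to(u,\mathcal L)$ with $A\in\mathcal N$, $u\in P_{N\cup\Sigma}(X)^+$ a uniquely $N$-labeled forest with $\mathrm{rk}(u)=\mathrm{rk}(A)$,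 and $\mathcal L\subseteq\mathcal N$ (the links) such that the sets $\mathrm{occ}(B)$, $B\in\mathcal L$, are pairwise disjoint with union $\mathrm{occ}_N(u)$. The sets $L(G,A)$, $A\in\mathcal N$, are simultaneously the smallest sets of forests such that for every rule $A\to(u,\mathcal L)$ and all $f(B)\in L(G,B)$ ($B\in\mathcal L$), $u[B\gets f(B)\mid B\in\mathcal L]\in L(G,A)$. $L(G)=L(G,S)\subseteq T_\Sigma$. **Derivation steps.** For every rule fix a linear order on its links. Elements of $\mathbb N^*$ serve as link identifiers; $\langle C,\ell\rangle\in N\times\mathbb N^*$ has the rank of $C$. For $A=(A_1,\dots,A_n)\in\mathcal N$ and $\ell\in\mathbb N^*$, $A\otimes\ell=(\langle A_1,\ell\rangle,\dots,\langle A_n,\ell\rangle)$; in particular $S\otimes\varepsilon=\langle S,\varepsilon\rangle$. For a rule $\rho=A\to(u,\mathcal L)$ with $\mathcal L=\{B_1,\dots,B_k\}$ (in order), $(u,\mathcal L)\otimes\ell=u[B_i\gets\mathrm{in}(B_i\otimes\ell i)\mid1\le i\le k]$, where $\ell i$ is $\ell$ extended by $i$. For $t_1,t_2\in T_{(N\times\mathbb N^* )\cup\Sigma}$, $t_1\Rightarrow_G t_2$ holds if there are a rule $\rho=A\to(u,\mathcal L)\in R$ and $\ell\in\mathbb N^*$ with $\mathrm{occ}(A\otimes\ell)=\mathrm{occ}_{N\times\{\ell\}}(t_1)$ and $t_2=t_1[A\otimes\ell\gets(u,\mathcal L)\otimes\ell]$. *)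

(* Defs.v *)
From HB Require Import structures.
From Stdlib Require Export Relation_Operators.
From mathcomp Require Export all_boot finmap.

Set Implicit Arguments.
Unset Strict Implicit.
Unset Printing Implicit Defensive.

(* Trees over [A] together with the variables; [Var i] is x_{i+1}.  Trees are
   raw terms: ranks and the allowed symbols are imposed by [is_tree]. *)
Inductive tree (A : Type) : Type :=
  | Var of nat
  | Node of A & seq (tree A).
Arguments Var {A} _.

Fixpoint tree_encode (A : Type) (t : tree A) : GenTree.tree (A + nat) :=
  match t with
  | Var i => GenTree.Leaf (inr i)
  | Node a ts => GenTree.Node 0 (GenTree.Leaf (inl a) :: map (@tree_encode A) ts)
  end.

Fixpoint tree_decode (A : Type) (g : GenTree.tree (A + nat)) : option (tree A) :=
  match g with
  | GenTree.Leaf (inr i) => Some (Var i)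
  | GenTree.Node _ (GenTree.Leaf (inl a) :: gs) =>
      Some (Node a (pmap (@tree_decode A) gs))
  | _ => None
  end.

Lemma tree_nested_ind (A : Type) (P : tree A -> Prop) :
  (forall i, P (Var i)) ->
  (forall a ts, foldr (fun t Q => P t /\ Q) True ts -> P (Node a ts)) ->
  forall t, P t.
Proof.
move=> PVar PNode; exact: (fix IH t : P t :=
  match t with
  | Var i => PVar i
  | Node a ts => PNode a ts
      ((fix IHs (ts : seq (tree A)) : foldr (fun t Q => P t /\ Q) True ts :=
         match ts with
         | [::] => I
         | t :: ts' => conj (IH t) (IHs ts')
         end) ts)
  end).
Qed.

Lemma tree_encodeK (A : Type) : pcancel (@tree_encode A) (@tree_decode A).
Proof.
elim/tree_nested_ind => [//|a ts IH] /=; congr (Some (Node a _)).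
by elim: ts IH => //= t ts IHts [-> /IHts ->].
Qed.

HB.instance Definition _ (A : choiceType) :=
  Choice.copy (tree A) (pcan_type (@tree_encodeK A)).

Fixpoint labels (A : Type) (t : tree A) : seq A :=
  if t is Node a ts then a :: flatten (map (@labels A) ts) else [::].

Fixpoint varocc (A : Type) (t : tree A) : seq nat :=
  match t with
  | Var i => [:: i]
  | Node _ ts => flatten (map (@varocc A) ts)
  end.

Definition flabels (A : Type) (u : seq (tree A)) : seq A :=
  flatten (map (@labels A) u).

(* Membership in T_{Omega u X_k}; for k = 0 this is T_Omega. *)
Fixpoint is_tree (A : Type) (rk : A -> nat) (Omega : pred A) (k : nat)
    (t : tree A) : bool :=
  match t with
  | Var i => i < k
  | Node a ts =>
      [&& Omega a, size ts == rk a & all (is_tree rk Omega k) ts]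
  end.

Definition is_pattern (A : Type) (rk : A -> nat) (Omega : pred A) (k : nat)
    (t : tree A) : bool :=
  is_tree rk Omega k t && all (fun i => count_mem i (varocc t) == 1) (iota 0 k).

Definition insym (A : Type) (rk : A -> nat) (a : A) : tree A :=
  Node a (mkseq Var (rk a)).

Fixpoint vsubst (A : Type) (s : seq (tree A)) (t : tree A) : tree A :=
  match t with
  | Var i => nth (Var i) s i
  | Node a ts => Node a (map (vsubst s) ts)
  end.

(* t[sigma <- u]; intended for [uniq sigma] and [size sigma = size u]. *)
Fixpoint subst (A : eqType) (sigma : seq A) (u : seq (tree A)) (t : tree A) :
    tree A :=
  match t with
  | Var i => Var i
  | Node a ts =>
      let ts' := map (subst sigma u) ts in
      if a \in sigma then vsubst ts' (nth (Node a ts') u (index a sigma))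
      else Node a ts'
  end.

Definition fsubst (A : eqType) (sigma : seq A) (u v : seq (tree A)) :
    seq (tree A) :=
  map (subst sigma u) v.

(* The ambient alphabet N u (N x NN^* ) u Sigma: [Nt C] is C, [Lnt C l] is
   <C, l>.  A link identifier is a word over NN = {1, 2, ...}; its letter i is
   stored as i - 1, so that [seq nat] is exactly NN^*. *)
Variant sym (N Sigma : Type) : Type :=
  | Nt of N
  | Lnt of N & seq nat
  | Tm of Sigma.
Arguments Nt {N Sigma} _.
Arguments Lnt {N Sigma} _ _.
Arguments Tm {N Sigma} _.

Definition sym_encode (N Sigma : Type) (a : sym N Sigma) :
    N + N * seq nat + Sigma :=
  match a with
  | Nt C => inl (inl C)
  | Lnt C l => inl (inr (C, l))
  | Tm s => inr s
  end.

Definition sym_decode (N Sigma : Type) (x : N + N * seq nat + Sigma) :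
    sym N Sigma :=
  match x with
  | inl (inl C) => Nt C
  | inl (inr (C, l)) => Lnt C l
  | inr s => Tm s
  end.

Lemma sym_encodeK (N Sigma : Type) :
  cancel (@sym_encode N Sigma) (@sym_decode N Sigma).
Proof. by case. Qed.

HB.instance Definition _ (N Sigma : choiceType) :=
  Choice.copy (sym N Sigma) (can_type (@sym_encodeK N Sigma)).

Definition srk (N Sigma : Type) (rkN : N -> nat) (rkS : Sigma -> nat)
    (a : sym N Sigma) : nat :=
  match a with
  | Nt C => rkN C
  | Lnt C _ => rkN C
  | Tm s => rkS s
  end.

Definition is_N (N Sigma : Type) (a : sym N Sigma) : bool :=
  if a is Nt _ then true else false.
Definition is_Lnt (N Sigma : Type) (a : sym N Sigma) : bool :=
  if a is Lnt _ _ then true else false.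
Definition is_Sigma (N Sigma : Type) (a : sym N Sigma) : bool :=
  if a is Tm _ then true else false.
Definition is_linked (N Sigma : Type) (l : seq nat) (a : sym N Sigma) : bool :=
  if a is Lnt _ l' then l' == l else false.

(* A rule A -> (u, L) is the tuple (A, (u, L)). *)
Definition rule (N Sigma : choiceType) : choiceType :=
  (seq N * (seq (tree (sym N Sigma)) * {fset seq N}))%type.
Definition lhs (N Sigma : choiceType) (r : rule N Sigma) : seq N := r.1.
Definition rhs (N Sigma : choiceType) (r : rule N Sigma) :
  seq (tree (sym N Sigma)) := r.2.1.
Definition links (N Sigma : choiceType) (r : rule N Sigma) : {fset seq N} :=
  r.2.2.

Record mcftg (N Sigma : finType) (rkN : N -> nat) (rkS : Sigma -> nat) :=
  MCFTG {
    bigN : {fset seq N};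
    start : N;
    rules : {fset rule N Sigma};
    bigN_nonempty : forall A, A \in bigN -> A != [::];
    bigN_uniq : forall A, A \in bigN -> uniq A;
    bigN_occ : forall A A', A \in bigN -> A' \in bigN -> A != A' ->
      ~ A =i A';
    terminals_rank : exists s : Sigma, 1 <= rkS s;
    start_bigN : [:: start] \in bigN;
    start_rank : rkN start = 0;
    rule_lhs : forall r, r \in rules -> lhs r \in bigN;
    rule_rhs : forall r, r \in rules ->
      all2 (is_pattern (srk rkN rkS) (predU (@is_N _ _) (@is_Sigma _ _)))
        (map rkN (lhs r)) (rhs r);
    rule_unique : forall r, r \in rules ->
      forall C : N, count_mem (Nt C) (flabels (rhs r)) <= 1;
    rule_links_bigN : forall r, r \in rules ->
      forall B, B \in links r -> B \in bigN;
    rule_links_disjoint : forall r, r \in rules ->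
      forall B B', B \in links r -> B' \in links r -> B != B' ->
        [disjoint B & B'];
    rule_links_cover : forall r, r \in rules ->
      forall C : N, (exists2 B, B \in links r & C \in B) <->
        Nt C \in flabels (rhs r)
  }.

(* The family L(G, A).  In the substitution, the links are enumerated in the
   canonical order of the finite set [links r]. *)
Inductive langA (N Sigma : finType) (rkN : N -> nat) (rkS : Sigma -> nat)
    (G : mcftg rkN rkS) : seq N -> seq (tree (sym N Sigma)) -> Prop :=
  | LangA (r : rule N Sigma) (f : seq N -> seq (tree (sym N Sigma))) :
      r \in rules G ->
      (forall B, B \in links r -> langA G B (f B)) ->
      langA G (lhs r)
        (fsubst (map Nt (flatten (enum_fset (links r))))
           (flatten (map f (enum_fset (links r)))) (rhs r)).

Definition lang (N Sigma : finType) (rkN : N -> nat) (rkS : Sigma -> nat)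
    (G : mcftg rkN rkS) (t : tree (sym N Sigma)) : Prop :=
  langA G [:: start G] [:: t].

(* A choice of a linear order on the links of every rule, each order being
   given as the increasing enumeration of the links. *)
Definition link_order (N Sigma : finType) (rkN : N -> nat) (rkS : Sigma -> nat)
    (G : mcftg rkN rkS) (ord : rule N Sigma -> seq (seq N)) : Prop :=
  forall r, r \in rules G -> uniq (ord r) /\ ord r =i links r.

Definition otimes (N Sigma : Type) (A : seq N) (l : seq nat) :
    seq (sym N Sigma) :=
  [seq Lnt C l | C <- A].

(* (u, L) (x) l for the rule r = A -> (u, L). *)
Definition rule_otimes (N Sigma : finType) (rkN : N -> nat)
    (rkS : Sigma -> nat) (ord : rule N Sigma -> seq (seq N))
    (r : rule N Sigma) (l : seq nat) : seq (tree (sym N Sigma)) :=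
  fsubst (map Nt (flatten (ord r)))
    (flatten
       (mkseq (fun i => map (insym (srk rkN rkS))
                          (otimes Sigma (nth [::] (ord r) i) (rcons l i)))
          (size (ord r))))
    (rhs r).

Definition is_sentential (N Sigma : finType) (rkN : N -> nat)
    (rkS : Sigma -> nat) (t : tree (sym N Sigma)) : bool :=
  is_tree (srk rkN rkS) (predU (@is_Lnt _ _) (@is_Sigma _ _)) 0 t.

Definition step (N Sigma : finType) (rkN : N -> nat) (rkS : Sigma -> nat)
    (G : mcftg rkN rkS) (ord : rule N Sigma -> seq (seq N))
    (t1 t2 : tree (sym N Sigma)) : Prop :=
  [/\ is_sentential rkN rkS t1, is_sentential rkN rkS t2 &
    exists r l,
      [/\ r \in rules G,
          otimes Sigma (lhs r) l =i [seq a <- labels t1 | is_linked l a] &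
          t2 = subst (otimes Sigma (lhs r) l)
                 (rule_otimes rkN rkS ord r l) t1]].

(* Main.v *)
Require Import Defs.
From Stdlib Require Import Operators_Properties.

(* Patterns delete no variable, so substitution loses no label and every argument
   below needs only the set of labels of a sentential form, not multiplicities.
   From L(G) to derivations, by induction on u in L(G, A): if the symbols with link
   identifier l in t are exactly A (x) l and no identifier in t properly extends
   l, then t derives t[A (x) l <- u]; apply the root rule at l, then expand the
   children l1, ..., lk one after the other.
   Conversely, every form t derivable from the start link has prefix-free link
   identifiers, each carrying one big nonterminal, and replacing every A (x) l in
   t by an arbitrary member of L(G, A) yields an element of L(G). A step t => t'
   at l preserves this: substituting in t' amounts to substituting in t, where
   the forest at l is obtained from those at l1, ..., lk by the applied rule. *)

Set Implicit Arguments.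
Unset Strict Implicit.
Unset Printing Implicit Defensive.

(** * Second-order substitution *)

Section Bind.

Variables (A : choiceType) (rk : A -> nat).
Implicit Types (a b : A) (t : tree A) (s ts : seq (tree A)).
Implicit Types (g h : A -> tree A).

Lemma tree_in_ind (P : tree A -> Prop) :
  (forall i, P (Var i)) ->
  (forall a ts, {in ts, forall t, P t} -> P (Node a ts)) ->
  forall t, P t.
Proof.
move=> PVar PNode; apply: tree_nested_ind => // a ts Pts; apply: PNode.
elim: ts Pts => //= t ts IHts [Pt /IHts Pts] t'.
by rewrite inE => /predU1P[->|/Pts].
Qed.

Definition ranked k t := is_tree rk predT k t.

(** The nondeleting half of the pattern condition: it makes every label of an argument survive a
    substitution. *)
Definition covers k t := forall i, i < k -> i \in varocc t.

(** Separates ranks from alphabets, so that the laws of substitution can be proved for [ranked]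
    alone and alphabets tracked through [labels]. *)
Lemma is_tree_ranked Omega k t :
  is_tree rk Omega k t = ranked k t && all Omega (labels t).
Proof.
rewrite /ranked; elim/tree_in_ind: t => [i|a ts IH] /=; first by rewrite andbT.
case: (Omega a); rewrite ?andbF //= -andbA; congr (_ && _).
have -> (s : seq (seq A)) : all Omega (flatten s) = all (all Omega) s.
  by elim: s => //= x s <-; rewrite all_cat.
rewrite all_map -all_predI; exact: eq_in_all.
Qed.

Lemma ranked_node k a ts :
  ranked k (Node a ts) = (size ts == rk a) && all (ranked k) ts.
Proof. by []. Qed.

Lemma mem_labels_node a b ts :
  reflect (a = b \/ exists2 t, t \in ts & a \in labels t)
    (a \in labels (Node b ts)).
Proof.
rewrite inE; apply: (iffP predU1P) => -[->|]; try by left.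
- by case/flatten_mapP=> t tts at_; right; exists t.
- by case=> t tts at_; right; apply/flatten_mapP; exists t.
Qed.

Lemma labels_child a b t ts :
  t \in ts -> a \in labels t -> a \in labels (Node b ts).
Proof. by move=> tts at_; apply/mem_labels_node; right; exists t. Qed.

Lemma ranked_varocc k t i : ranked k t -> i \in varocc t -> i < k.
Proof.
elim/tree_in_ind: t => [j|a ts IH] /=; first by rewrite inE => ? /eqP->.
rewrite ranked_node => /andP[_ /allP rts] /flatten_mapP[t tts].
exact: IH (rts _ tts).
Qed.

Lemma ranked_vsubst k s t :
  ranked (size s) t -> all (ranked k) s -> ranked k (vsubst s t).
Proof.
move=> + /allP rs; elim/tree_in_ind: t => [i|a ts IH] /=.
  by move=> lti; apply: rs; rewrite mem_nth.
rewrite !ranked_node size_map all_map => /andP[-> /allP rts] /=.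
by apply/allP => t tts; apply: IH (rts _ tts).
Qed.

Lemma mem_labels_vsubst a s t :
  reflect (a \in labels t \/
           exists2 i, i \in varocc t & a \in labels (nth (Var i) s i))
    (a \in labels (vsubst s t)).
Proof.
apply: (iffP idP); elim/tree_in_ind: t => [i|b ts IH] /=.
- by move=> ai; right; exists i; rewrite ?inE.
- case/mem_labels_node=> [->|[_ /mapP[t tts ->] /(IH _ tts)[at_|[i it ai]]]].
  + by left; rewrite inE eqxx.
  + by left; apply: labels_child at_.
  + by right; exists i => //; apply/flatten_mapP; exists t.
- by case=> // -[j]; rewrite inE => /eqP->.
- case=> [/mem_labels_node[->|[t tts at_]]|[i /flatten_mapP[t tts it] ai]].
  + by rewrite inE eqxx.
  + by apply: labels_child (map_f _ tts) _; apply: IH => //; left.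
  + by apply: labels_child (map_f _ tts) _; apply: IH => //; right; exists i.
Qed.

Lemma mem_varocc_vsubst i s t :
  reflect (exists2 j, j \in varocc t & i \in varocc (nth (Var j) s j))
    (i \in varocc (vsubst s t)).
Proof.
apply: (iffP idP); elim/tree_in_ind: t => [j|b ts IH] /=.
- by move=> ij; exists j; rewrite ?inE.
- case/flatten_mapP=> _ /mapP[t tts ->] /(IH _ tts)[j jt ij].
  by exists j => //; apply/flatten_mapP; exists t.
- by case=> k; rewrite inE => /eqP->.
- case=> j /flatten_mapP[t tts jt] ij; apply/flatten_mapP.
  by exists (vsubst s t); rewrite ?map_f //; apply: IH => //; exists j.
Qed.

(** [ranked] keeps every variable within [s]; beyond it the left side would still substitute from
    [s'], while the right side would leave the variable. *)
Lemma vsubst_vsubst s' s t : ranked (size s) t ->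
  vsubst s' (vsubst s t) = vsubst (map (vsubst s') s) t.
Proof.
elim/tree_in_ind: t => [i|a ts IH] /=.
  by move=> lti; rewrite (nth_map (Var i)).
rewrite ranked_node => /andP[_ /allP rts]; rewrite -map_comp.
congr Node; apply/eq_in_map => t tts; exact: IH (rts _ tts).
Qed.

Lemma vsubst_Var k t : ranked k t -> vsubst (mkseq Var k) t = t.
Proof.
elim/tree_in_ind: t => [i|a ts IH] /=; first by move=> lti; rewrite nth_mkseq.
rewrite ranked_node => /andP[_ /allP rts]; congr Node; rewrite -[RHS]map_id.
by apply/eq_in_map => t tts; apply: IH (rts _ tts).
Qed.

(* A symbol [a] is left alone by setting [h a = insym rk a]: on ranked trees this
   is a monad with unit [insym rk]. *)
Fixpoint bind h t : tree A :=
  match t with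
  | Var i => Var i
  | Node a ts => vsubst (map (bind h) ts) (h a)
  end.

Lemma eq_in_bind h1 h2 t : {in labels t, h1 =1 h2} -> bind h1 t = bind h2 t.
Proof.
elim/tree_in_ind: t => //= a ts IH eqh.
rewrite eqh ?inE ?eqxx //; congr vsubst; apply/eq_in_map => t tts.
by apply: IH => // b bt; apply: eqh; apply: labels_child bt.
Qed.

Lemma ranked_insym a : ranked (rk a) (insym rk a).
Proof.
rewrite ranked_node size_mkseq eqxx /= all_map.
by apply/allP => i; rewrite mem_iota.
Qed.

Lemma labels_insym a : labels (insym rk a) = [:: a].
Proof. by rewrite /= /mkseq -map_comp; elim: (iota _ _). Qed.

Lemma covers_insym a : covers (rk a) (insym rk a).
Proof.
move=> i lti; apply/flatten_mapP; exists (Var i); last by rewrite inE.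
by rewrite map_f // mem_iota.
Qed.

Lemma bind_insym g a : ranked (rk a) (g a) -> bind g (insym rk a) = g a.
Proof.
move=> rg; rewrite /= /mkseq -map_comp; exact: vsubst_Var.
Qed.

Lemma vsubst_insym a ts : size ts = rk a -> vsubst ts (insym rk a) = Node a ts.
Proof.
move=> szts; rewrite /= /mkseq -map_comp; congr Node.
apply: (@eq_from_nth _ (Var 0)); rewrite ?size_map ?size_iota // => i lti.
rewrite (nth_map 0) ?size_iota //= nth_iota // add0n.
by apply: set_nth_default; rewrite szts.
Qed.

Lemma bind_id k t : ranked k t -> bind (insym rk) t = t.
Proof.
elim/tree_in_ind: t => // a ts IH.
rewrite ranked_node => /andP[/eqP szts /allP rts].
rewrite [LHS]vsubst_insym ?size_map //; congr Node; rewrite -[RHS]map_id.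
by apply/eq_in_map => t tts; apply: IH (rts _ tts).
Qed.

Lemma bind_vsubst g k s t : ranked k t ->
    {in labels t, forall a, ranked (rk a) (g a)} ->
  bind g (vsubst s t) = vsubst (map (bind g) s) (bind g t).
Proof.
elim/tree_in_ind: t => [i|a ts IH] /=.
  move=> _ _; case: (ltnP i (size s)) => lti.
    by rewrite (nth_map (Var i)).
  by rewrite !nth_default ?size_map.
rewrite ranked_node => /andP[/eqP szts /allP rts] rg.
rewrite vsubst_vsubst ?size_map ?szts; last by apply: rg; rewrite inE eqxx.
rewrite -!map_comp; congr vsubst; apply/eq_in_map => t tts.
by apply: IH (rts _ tts) _ => // b bt; apply: rg; apply: labels_child bt.
Qed.

(** Associativity of the monad. The rank conditions are confined to labels that occur, because the
    assignments used later are controlled only there. *)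
Lemma bind_bind g h k t : ranked k t ->
    {in labels t, forall b, ranked (rk b) (h b)} ->
    {in labels t, forall b, {in labels (h b), forall a, ranked (rk a) (g a)}} ->
  bind g (bind h t) = bind (bind g \o h) t.
Proof.
elim/tree_in_ind: t => //= a ts IH.
rewrite ranked_node => /andP[_ /allP rts] rh rg.
have aN : a \in labels (Node a ts) by rewrite inE eqxx.
rewrite (bind_vsubst _ (rh a aN) (rg a aN)) -map_comp.
congr vsubst; apply/eq_in_map => t tts.
by apply: IH (rts _ tts) _ _ => // b bt;
  [apply: rh | apply: rg]; apply: labels_child bt.
Qed.

Lemma ranked_bind h k t : ranked k t ->
  {in labels t, forall b, ranked (rk b) (h b)} -> ranked k (bind h t).
Proof.
elim/tree_in_ind: t => //= a ts IH.
rewrite ranked_node => /andP[/eqP szts /allP rts] rh.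
apply: ranked_vsubst.
  by rewrite size_map szts; apply: rh; rewrite inE eqxx.
rewrite all_map; apply/allP => t tts; apply: IH (rts _ tts) _ => // b bt.
by apply: rh; apply: labels_child bt.
Qed.

Lemma nth_map_bind h ts i : i < size ts ->
  nth (Var i) (map (bind h) ts) i = bind h (nth (Var 0) ts i).
Proof. by move=> lti; rewrite (nth_map (Var 0)). Qed.

(** With [mem_labels_bind], the labels of [bind h t] are exactly those of the images. This inclusion
    uses ranks, which keep variables in range; the converse uses [covers], which keeps arguments
    from being dropped. *)
Lemma mem_labels_bindW h k t a : ranked k t ->
    {in labels t, forall b, ranked (rk b) (h b)} ->
  a \in labels (bind h t) -> exists2 b, b \in labels t & a \in labels (h b).
Proof.
elim/tree_in_ind: t => //= c ts IH.
rewrite ranked_node => /andP[/eqP szts /allP rts] rh.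
have cN : c \in labels (Node c ts) by rewrite inE eqxx.
case/mem_labels_vsubst=> [ac|[i /(ranked_varocc (rh _ cN))]]; first by exists c.
rewrite -szts => lti; rewrite nth_map_bind // => abi.
have tts := mem_nth (Var 0) lti.
have [|b bt ab] := IH _ tts (rts _ tts) _ abi.
  by move=> b bt; apply: rh; apply: labels_child bt.
by exists b => //; apply: labels_child bt.
Qed.

Lemma mem_labels_bind h k t a b : ranked k t ->
    {in labels t, forall b, covers (rk b) (h b)} ->
  b \in labels t -> a \in labels (h b) -> a \in labels (bind h t).
Proof.
elim/tree_in_ind: t => //= c ts IH.
rewrite ranked_node => /andP[/eqP szts /allP rts] ch.
case/mem_labels_node=> [->|[t tts bt]] ab; apply/mem_labels_vsubst.
  by left.
have lti : index t ts < size ts by rewrite index_mem.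
right; exists (index t ts); first by apply: ch; rewrite -?szts // inE eqxx.
rewrite nth_map_bind // nth_index //; apply: IH (rts _ tts) _ bt ab => //.
by move=> d dt; apply: ch; apply: labels_child dt.
Qed.

Lemma mem_varocc_bind h k t i : ranked k t ->
    {in labels t, forall b, covers (rk b) (h b)} ->
  i \in varocc t -> i \in varocc (bind h t).
Proof.
elim/tree_in_ind: t => //= c ts IH.
rewrite ranked_node => /andP[/eqP szts /allP rts] ch.
case/flatten_mapP=> t tts it; apply/mem_varocc_vsubst.
have lti : index t ts < size ts by rewrite index_mem.
exists (index t ts); first by apply: ch; rewrite -?szts // inE eqxx.
rewrite nth_map_bind // nth_index //; apply: IH (rts _ tts) _ it => //.
by move=> d dt; apply: ch; apply: labels_child dt.
Qed.

(** The bridge from positional substitution to [bind]: since the replacing forest is the image of a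
    function [w], the position of a symbol in [L] no longer matters. *)
Lemma subst_bind (C : eqType) (c : C -> A) (L : seq C) (w : C -> tree A) h k t :
    injective c -> ranked k t ->
    {in L, forall x, h (c x) = w x} ->
    {in labels t, forall a, a \notin map c L -> h a = insym rk a} ->
  subst (map c L) (map w L) t = bind h t.
Proof.
move=> injc + hc; elim/tree_in_ind: t => //= a ts IH.
rewrite ranked_node => /andP[/eqP szts /allP rts] hN.
have -> : map (subst (map c L) (map w L)) ts = map (bind h) ts.
  apply/eq_in_map => t tts; apply: IH (rts _ tts) _ => // b bt.
  by apply: hN; apply: labels_child bt.
case: ifPn => [/mapP[x xL ->]|aN].
  by rewrite index_map // (nth_map x) ?index_mem // nth_index // hc.
by rewrite hN ?inE ?eqxx // vsubst_insym // size_map.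
Qed.

End Bind.

(** The first sequence found and [B] share [x], so disjointness identifies them. *)
Lemma find_disjoint (C : finType) (L : seq (seq C)) (B : seq C) (x : C) :
    {in L &, forall B1 B2 : seq C, B1 != B2 -> [disjoint B1 & B2]} ->
    B \in L -> x \in B ->
  nth [::] L (find (fun B' : seq C => x \in B') L) = B.
Proof.
move=> disL BL xB; set P := fun _ => _.
have hasP : has P L by apply/hasP; exists B.
apply/eqP/negPn/negP => neq.
have /disL/(_ BL neq) : nth [::] L (find P L) \in L.
  by rewrite mem_nth -?has_find.
by move/disjointFr/(_ (nth_find [::] hasP)); rewrite xB.
Qed.

(** * The languages L(G, A) *)

Section Grammar.

Variables (N Sigma : finType) (rkN : N -> nat) (rkS : Sigma -> nat).
Variable G : mcftg rkN rkS.
Local Notation symb := (sym N Sigma).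
Local Notation rk := (@srk N Sigma rkN rkS).
Implicit Types (r : rule N Sigma) (A B : seq N) (C D : N) (l : seq nat).
Implicit Types (t : tree symb) (F : seq (tree symb)).

Definition nsub (g : N -> tree symb) (a : symb) : tree symb :=
  if a is Nt C then g C else insym rk a.

Definition lsub (g : N -> seq nat -> tree symb) (a : symb) : tree symb :=
  if a is Lnt C l then g C l else insym rk a.

(** Indexes the right-hand forest by nonterminals instead of positions, which is faithful because
    [lhs r] is repetition-free. *)
Definition body r C : tree symb := nth (Var 0) (rhs r) (index C (lhs r)).

Definition terminal_pattern k t :=
  [/\ ranked rk k t, covers k t & all (@is_Sigma N Sigma) (labels t)].

Lemma size_rhs r : r \in rules G -> size (rhs r) = size (lhs r).
Proof. by move/rule_rhs; rewrite all2E size_map => /andP[/eqP]. Qed.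

Lemma rhs_body r : r \in rules G -> rhs r = map (body r) (lhs r).
Proof.
move=> rG; apply: (@eq_from_nth _ (Var 0)).
  by rewrite size_map size_rhs.
move=> i; rewrite size_rhs // => lti.
(* [N] may be empty, so the default element for [nth] is the head of the nonempty [lhs r]. *)
case E: (lhs r) lti => [//|C0 A0]; rewrite -E => lti.
by rewrite (nth_map C0) // /body index_uniq // (bigN_uniq (rule_lhs rG)).
Qed.

Lemma bodyP r C : r \in rules G -> C \in lhs r ->
  [/\ ranked rk (rkN C) (body r C), covers (rkN C) (body r C)
    & all (predU (@is_N _ _) (@is_Sigma _ _)) (labels (body r C))].
Proof.
move=> rG Clhs; have lti : index C (lhs r) < size (lhs r) by rewrite index_mem.
have := rule_rhs rG; rewrite all2E => /andP[/eqP sz].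
move/(all_nthP (0, Var 0))/(_ (index C (lhs r))).
rewrite size_zip -sz minnn size_map nth_zip //= => /(_ lti).
rewrite (nth_map C) // nth_index // -/(body r C) /is_pattern is_tree_ranked.
case/andP=> /andP[-> ->] /allP cnt; split=> // i lti'.
by rewrite -has_pred1 has_count (eqP (cnt i _)) // mem_iota.
Qed.

Lemma body_link r C D : r \in rules G -> C \in lhs r ->
  Nt D \in labels (body r C) -> exists2 B, B \in links r & D \in B.
Proof.
move=> rG Clhs Db; apply/(rule_links_cover rG)/flatten_mapP.
by exists (body r C) => //; rewrite rhs_body // map_f.
Qed.

Lemma link_body r B D : r \in rules G -> B \in links r -> D \in B ->
  exists2 C, C \in lhs r & Nt D \in labels (body r C).
Proof.
move=> rG Br DB; have /(rule_links_cover rG)/flatten_mapP[u] :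
  exists2 B, B \in links r & D \in B by exists B.
by rewrite rhs_body // => /mapP[C Clhs ->] Du; exists C.
Qed.

Lemma Nt_inj : injective (@Nt N Sigma).
Proof. by move=> C D []. Qed.

(** Stated for any enumeration [L] of the links: it serves the canonical order in [langA] as well as
    the chosen order [ord r] in derivation steps. *)
Lemma fsubst_links r (L : seq (seq N)) (g : N -> tree symb) :
    r \in rules G -> L =i links r ->
  fsubst (map Nt (flatten L)) (map g (flatten L)) (rhs r) =
  map (bind (nsub g) \o body r) (lhs r).
Proof.
move=> rG Lr; rewrite /fsubst rhs_body // -map_comp.
apply/eq_in_map => C Clhs /=; have [rb _ ab] := bodyP rG Clhs.
apply: (subst_bind Nt_inj rb) => // -[D|//|//] Db.
have [B] := body_link rG Clhs Db; rewrite -Lr => BL DB.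
by case/negP; apply: map_f; apply/flattenP; exists B.
Qed.

Lemma links_disjoint r (L : seq (seq N)) : r \in rules G -> L =i links r ->
  {in L &, forall B1 B2 : seq N, B1 != B2 -> [disjoint B1 & B2]}.
Proof.
move=> rG Lr B1 B2; rewrite !Lr; exact: (rule_links_disjoint rG).
Qed.

Lemma langA_size A F : langA G A F -> size F = size A.
Proof. by case=> r f rG _; rewrite size_map size_rhs. Qed.

Lemma langA_rule r (g : N -> tree symb) : r \in rules G ->
    (forall B, B \in links r -> langA G B (map g B)) ->
  langA G (lhs r) (map (bind (nsub g) \o body r) (lhs r)).
Proof.
move=> rG gL; rewrite -(@fsubst_links _ (enum_fset (links r))) // (map_flatten g).
exact: LangA.
Qed.

(** Induction on L(G, A) in which one function [g] on nonterminals replaces the family of forests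
    [f B]. Links are disjoint, so each nonterminal [D] lies in a single link [lk D] and [g D] is its
    component of [f (lk D)]. *)
Lemma langA_body_ind (P : seq N -> seq (tree symb) -> Prop) :
    (forall r (g : N -> tree symb), r \in rules G ->
       (forall B, B \in links r -> langA G B (map g B)) ->
       (forall B, B \in links r -> P B (map g B)) ->
     P (lhs r) (map (bind (nsub g) \o body r) (lhs r))) ->
  forall A F, langA G A F -> P A F.
Proof.
move=> PI A F; elim=> {A F} r f rG fL fP.
set L := enum_fset _; have Lr : L =i links r by [].
pose lk D := nth [::] L (find (fun B' : seq N => D \in B') L).
pose g D := nth (Var 0) (f (lk D)) (index D (lk D)).
have gf B : B \in links r -> map g B = f B.
  move=> Br; have szf := langA_size (fL _ Br).
  apply: (@eq_from_nth _ (Var 0)); rewrite size_map // => i lti.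
  case E: B lti => [//|D0 B0]; rewrite -E => lti.
  have lkB : lk (nth D0 B i) = B.
    by apply: find_disjoint (links_disjoint rG Lr) Br (mem_nth _ lti).
  rewrite (nth_map D0) // /g lkB index_uniq //.
  exact: bigN_uniq (rule_links_bigN rG Br).
have -> : flatten (map f L) = map g (flatten L).
  by rewrite map_flatten; congr flatten; apply/eq_in_map => B /gf.
rewrite fsubst_links //; apply: PI => // B Br; rewrite gf //.
- exact: fL.
- exact: fP.
Qed.

Lemma terminal_pattern_bind r C (g : N -> tree symb) :
    r \in rules G -> C \in lhs r ->
    (forall B D, B \in links r -> D \in B -> terminal_pattern (rkN D) (g D)) ->
  terminal_pattern (rkN C) (bind (nsub g) (body r C)).
Proof.
move=> rG Clhs gT; have [rb cb ab] := bodyP rG Clhs.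
have gD D : Nt D \in labels (body r C) -> terminal_pattern (rkN D) (g D).
  by case/body_link=> // B; apply: gT.
have rn : {in labels (body r C), forall a, ranked rk (rk a) (nsub g a)}.
  by move=> [D /gD[]//|D l _|s _]; apply: ranked_insym.
have cn : {in labels (body r C), forall a, covers (rk a) (nsub g a)}.
  by move=> [D /gD[]//|D l _|s _]; apply: covers_insym.
split.
- exact: ranked_bind.
- by move=> i /cb; apply: mem_varocc_bind rb cn.
- apply/allP=> a /(mem_labels_bindW rb rn)[[D /gD[_ _ /allP]|D l|s]] //.
  + by apply.
  + by move/(allP ab).
  + by move=> _; rewrite [nsub _ _]/= labels_insym inE => /eqP->.
Qed.

Lemma langA_terminal A F : langA G A F ->
  forall C, C \in A ->
  terminal_pattern (rkN C) (nth (Var 0) F (index C A)).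
Proof.
move=> AF; elim/langA_body_ind: A F / AF => r g rG _ IH C Clhs.
rewrite (nth_map C) ?index_mem // nth_index //.
apply: terminal_pattern_bind => // B D Br DB.
by have := IH B Br D DB; rewrite (nth_map D) ?index_mem // nth_index.
Qed.

Lemma langA_map_terminal A (g : N -> tree symb) C :
  langA G A (map g A) -> C \in A -> terminal_pattern (rkN C) (g C).
Proof.
move=> /langA_terminal AF CA; have := AF C CA.
by rewrite (nth_map C) ?index_mem // nth_index.
Qed.

(** * Links in sentential forms *)

Definition sentential_pattern k t :=
  [/\ ranked rk k t, covers k t
    & all (predU (@is_Lnt _ _) (@is_Sigma _ _)) (labels t)].

(** At rank 0 the [covers] condition is vacuous. *)
Lemma is_sententialP t :
  is_sentential rkN rkS t <-> sentential_pattern 0 t.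
Proof.
rewrite /is_sentential is_tree_ranked.
by split=> [/andP[]|[-> _ ->]].
Qed.

Lemma terminal_sentential k t : terminal_pattern k t -> sentential_pattern k t.
Proof.
by case=> rt ct st; split=> //; apply: sub_all st => a /= ->; rewrite orbT.
Qed.

Lemma sentential_insym C l :
  sentential_pattern (rkN C) (insym rk (Lnt C l)).
Proof.
split; last by rewrite labels_insym.
- exact: (ranked_insym rk (Lnt C l)).
- exact: (@covers_insym _ rk (Lnt C l)).
Qed.

Section Lsub.

Variables (g : N -> seq nat -> tree symb) (t : tree symb).
Hypothesis st : is_sentential rkN rkS t.
Hypothesis sg : forall C l, Lnt C l \in labels t ->
  sentential_pattern (rkN C) (g C l).

Lemma ranked_lsub : {in labels t, forall a, ranked rk (rk a) (lsub g a)}.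
Proof. by move=> [D _|D l /sg[]|s _] //; apply: ranked_insym. Qed.

Lemma covers_lsub : {in labels t, forall a, covers (rk a) (lsub g a)}.
Proof. by move=> [D _|D l /sg[]|s _] //; apply: covers_insym. Qed.

Lemma Lnt_labels_lsub D l :
  Lnt D l \in labels (bind (lsub g) t) <->
  exists C l', Lnt C l' \in labels t /\ Lnt D l \in labels (g C l').
Proof.
have /is_sententialP[rt _ at_] := st; split.
  case/(mem_labels_bindW rt ranked_lsub)=> -[C|C l' Ct Dg|s _].
  - by move/(allP at_).
  - by exists C, l'.
  - by rewrite [lsub _ _]/= labels_insym inE.
case=> C [l' [Ct Dg]]; exact: mem_labels_bind rt covers_lsub Ct Dg.
Qed.

Lemma sentential_lsub : is_sentential rkN rkS (bind (lsub g) t).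
Proof.
have /is_sententialP[rt _ at_] := st; apply/is_sententialP; split=> //.
  exact: ranked_bind rt ranked_lsub.
apply/allP=> a /(mem_labels_bindW rt ranked_lsub)[[C|C l|s _]].
- by move/(allP at_).
- by move=> /sg[_ _ /allP]; apply.
- by rewrite [lsub _ _]/= labels_insym inE => /eqP->.
Qed.

End Lsub.

Definition linked A l t :=
  otimes Sigma A l =i [seq a <- labels t | is_linked l a].

Lemma Lnt_inj l : injective (fun C => Lnt C l : symb).
Proof. by move=> C D []. Qed.

Lemma linkedP A l t :
  linked A l t <-> forall C, (C \in A) = (Lnt C l \in labels t).
Proof.
split=> [lA C|lA a].
  have := lA (Lnt C l); rewrite mem_filter /= eqxx /= => <-.
  by rewrite (mem_map (@Lnt_inj l)).
rewrite mem_filter; case: a => [C|C l'|s] /=; try by apply/negP=> /mapP[].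
case: eqP => [->|nl] /=; first by rewrite (mem_map (@Lnt_inj l)).
by apply/negP=> /mapP[D _ [_ /nl]].
Qed.

(** Distinct big nonterminals have distinct sets of symbols, so the form determines which one sits
    at [l]. *)
Lemma linked_inj A B l t : A \in bigN G -> B \in bigN G ->
  linked A l t -> linked B l t -> A = B.
Proof.
move=> AG BG /linkedP lA /linkedP lB; apply/eqP/negPn/negP => AB.
by apply: (bigN_occ AG BG AB) => C; rewrite lA lB.
Qed.

Lemma linked_mem A l t : A \in bigN G -> linked A l t ->
  exists2 C, C \in A & Lnt C l \in labels t.
Proof.
move=> /bigN_nonempty; case: A => // C A _ /linkedP lA.
by exists C; rewrite -?lA inE eqxx.
Qed.

(** * Child identifiers and the effect of applying a rule at a link *)

Variable ord : rule N Sigma -> seq (seq N).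
Hypothesis ordG : link_order G ord.

(** The zero-based position of the link that contains [D]; it is the last letter of the identifier
    that [D] receives. *)
Definition link_index r D := find (fun B : seq N => D \in B) (ord r).

Lemma nth_link_index r B D : r \in rules G -> B \in links r -> D \in B ->
  nth [::] (ord r) (link_index r D) = B.
Proof.
move=> rG Br DB; have [_ ordr] := ordG rG.
by apply: find_disjoint (links_disjoint rG ordr) _ DB; rewrite ordr.
Qed.

Lemma link_index_lt r B D : r \in rules G -> B \in links r -> D \in B ->
  link_index r D < size (ord r).
Proof.
move=> rG Br DB; rewrite -has_find; apply/hasP; exists B => //.
by have [_ ->] := ordG rG.
Qed.

Lemma link_indexE r i D : r \in rules G -> i < size (ord r) ->
  D \in nth [::] (ord r) i -> link_index r D = i.
Proof.
move=> rG lti Di; have [uord ordr] := ordG rG.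
have Br : nth [::] (ord r) i \in links r by rewrite -ordr mem_nth.
apply/eqP; rewrite -(nth_uniq [::] _ lti uord) ?(link_index_lt rG Br) //.
by rewrite (nth_link_index rG Br).
Qed.

Definition child r l D : tree symb :=
  insym rk (Lnt D (rcons l (link_index r D))).

(** The child identifier of a symbol can be read off the symbol itself through [link_index], so the
    relabelled right-hand side is a binding as well. *)
Lemma rule_otimesE r l : r \in rules G ->
  rule_otimes rkN rkS ord r l =
  map (bind (nsub (child r l)) \o body r) (lhs r).
Proof.
move=> rG; have [uord ordr] := ordG rG; rewrite /rule_otimes.
rewrite -(fsubst_links _ rG ordr); congr fsubst.
rewrite (map_flatten (child _ _)).
congr flatten; rewrite -[in RHS](mkseq_nth [::] (ord r)) -map_comp.
apply/eq_in_map => i; rewrite mem_iota => /andP[_ lti] /=.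
rewrite /otimes -map_comp; apply/eq_in_map => D Di /=.
by rewrite /child (link_indexE rG _ Di).
Qed.

Definition at_link l (g : N -> tree symb) C l' : tree symb :=
  if l' == l then g C else insym rk (Lnt C l').

Definition fire r l := at_link l (bind (nsub (child r l)) \o body r).

Lemma subst_fire r l t : r \in rules G -> ranked rk 0 t ->
    linked (lhs r) l t ->
  subst (otimes Sigma (lhs r) l) (rule_otimes rkN rkS ord r l) t =
  bind (lsub (fire r l)) t.
Proof.
move=> rG rt /linkedP lr; rewrite rule_otimesE //.
apply: (subst_bind (@Lnt_inj l) rt) => [C _|a at_ aN].
  by rewrite /= /fire /at_link eqxx.
(* Only linked symbols need an argument: by [linked], one that carries [l] belongs to [lhs r]. *)
case: a at_ aN => //= C l' Ct; rewrite /fire /at_link.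
by case: eqP => // el; rewrite el -lr in Ct; rewrite el map_f.
Qed.

Section Fire.

Variables (r : rule N Sigma) (l : seq nat) (t : tree symb).
Hypothesis (rG : r \in rules G) (st : is_sentential rkN rkS t).
Hypothesis lr : linked (lhs r) l t.

Lemma ranked_child C :
  {in labels (body r C), forall a, ranked rk (rk a) (nsub (child r l) a)}.
Proof.
by move=> [D _|D l' _|s _]; [exact: (ranked_insym rk (Lnt _ _))|..];
  apply: ranked_insym.
Qed.

Lemma covers_child C :
  {in labels (body r C), forall a, covers (rk a) (nsub (child r l) a)}.
Proof.
by move=> [D _|D l' _|s _]; [exact: (@covers_insym _ rk (Lnt _ _))|..];
  apply: covers_insym.
Qed.

Lemma sentential_fire C l' : Lnt C l' \in labels t ->
  sentential_pattern (rkN C) (fire r l C l').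
Proof.
rewrite /fire /at_link; case: eqP => [->|_ _]; last exact: sentential_insym.
have /linkedP <- := lr; move=> /(bodyP rG)[rb cb ab] /=; split.
- exact: ranked_bind rb (@ranked_child C).
- by move=> i /cb; apply: mem_varocc_bind rb (@covers_child C).
- apply/allP=> a /(mem_labels_bindW rb (@ranked_child C))[[D _|D l1|s _]].
  + by rewrite /nsub /child labels_insym inE => /eqP->.
  + by move/(allP ab).
  + by rewrite /nsub labels_insym inE => /eqP->.
Qed.

(** Right-hand patterns cover their variables, so nothing is lost and the links after a step are
    known exactly. Both directions of the theorem rest on this description. *)
Lemma Lnt_labels_fire D l' :
  Lnt D l' \in labels (bind (lsub (fire r l)) t) <->
  (Lnt D l' \in labels t /\ l' <> l) \/
  (exists2 B, B \in links r & D \in B /\ l' = rcons l (link_index r D)).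
Proof.
rewrite (Lnt_labels_lsub st sentential_fire); split.
  case=> C [l1 [Ct]]; rewrite /fire /at_link; case: eqP => [el|nl].
    rewrite el in Ct; have /linkedP lr' := lr; rewrite -lr' in Ct.
    have [rb _ ab] := bodyP rG Ct.
    case/(mem_labels_bindW rb (@ranked_child C))=> -[D1 D1b|D1 l2|s _].
    - rewrite /nsub /child labels_insym inE => /eqP[-> ->]; right.
      by have [B Br D1B] := body_link rG Ct D1b; exists B.
    - by move/(allP ab).
    - by rewrite /nsub labels_insym inE.
  by rewrite labels_insym inE => /eqP[-> ->]; left.
case=> [[Dt nl]|[B Br [DB el]]].
  exists D, l'; split=> //; rewrite /fire /at_link; move/eqP/negPf: nl => ->.
  by rewrite labels_insym inE.
have [C Clhs Db] := link_body rG Br DB; have [rb _ _] := bodyP rG Clhs.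
exists C, l; rewrite -(iffLR (linkedP _ _ _) lr); split=> //.
rewrite /fire /at_link eqxx /=.
apply: mem_labels_bind rb (@covers_child C) Db _.
by rewrite /nsub /child labels_insym inE el.
Qed.

Lemma step_fire : step G ord t (bind (lsub (fire r l)) t).
Proof.
split=> //; first exact: sentential_lsub st sentential_fire.
exists r, l; split=> //; rewrite subst_fire //.
by have /is_sententialP[] := st.
Qed.

End Fire.

(** * From L(G, A) to derivations *)

Lemma is_Sigma_Lnt C l t : all (@is_Sigma N Sigma) (labels t) ->
  Lnt C l \notin labels t.
Proof. by move=> /allP tT; apply/negP => /tT. Qed.

Lemma bind_lsub_terminal (f : N -> seq nat -> tree symb) k t :
  terminal_pattern k t -> bind (lsub f) t = t.
Proof.
case=> rt _ /allP tT; rewrite -[RHS](bind_id rt).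
by apply: eq_in_bind => -[C|C l|s] // /tT.
Qed.

Lemma bind_lsub_insym (f : N -> seq nat -> tree symb) C l :
  ranked rk (rkN C) (f C l) ->
  bind (lsub f) (insym rk (Lnt C l)) = f C l.
Proof. by move=> rf; rewrite (bind_insym (g := lsub f)). Qed.

Lemma bind_lsub_Tm (f : N -> seq nat -> tree symb) (s : Sigma) :
  bind (lsub f) (insym rk (Tm s)) = insym rk (Tm s).
Proof. by rewrite (bind_insym (g := lsub f)) //; apply: ranked_insym. Qed.

Definition link_maximal l t :=
  forall C l', Lnt C l' \in labels t -> prefix l l' -> l' = l.

(** Maximality of [l] is used in this form: the identifiers of its children are fresh. *)
Lemma link_maximal_rcons l i t C : link_maximal l t ->
  Lnt C (rcons l i) \notin labels t.
Proof.
move=> lt; apply/negP=> /lt /(_ (prefix_rcons _ _)) /(congr1 size).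
by rewrite size_rcons => /eqP; rewrite eqn_leq ltnn.
Qed.

Section Instantiate.

Variables (r : rule N Sigma) (g : N -> tree symb) (l : seq nat) (t : tree symb).
Hypothesis rG : r \in rules G.
Hypothesis gL : forall B, B \in links r -> langA G B (map g B).
Hypothesis st : is_sentential rkN rkS t.
Hypothesis lr : linked (lhs r) l t.
Hypothesis lt : link_maximal l t.

Let t0 := bind (lsub (fire r l)) t.

(* Expands only the children of [l] of index below [i], so that [T i] below is
   the form reached after the first [i] children. *)
Let E i C l' : tree symb :=
  if (l' == rcons l (link_index r C)) && (link_index r C < i)
  then g C else insym rk (Lnt C l').

Let T i := bind (lsub (E i)) t0.

Let st0 : is_sentential rkN rkS t0.
Proof. exact: sentential_lsub st (sentential_fire rG lr). Qed.

(** A child identifier of [l] is fresh for [t], so in [t0] it comes from a link of [r], where [g]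
    takes values in the language. *)
Let t0_child C : Lnt C (rcons l (link_index r C)) \in labels t0 ->
  terminal_pattern (rkN C) (g C).
Proof.
case/(Lnt_labels_fire rG st lr)=> [[Ct _]|[B /gL BL [CB _]]].
  by have := link_maximal_rcons (link_index r C) C lt; rewrite Ct.
exact: langA_map_terminal BL CB.
Qed.

Let sE i C l' : Lnt C l' \in labels t0 -> sentential_pattern (rkN C) (E i C l').
Proof.
rewrite /E; case: eqP => [->|_ _] /=; last exact: sentential_insym.
move=> Ct; case: ifP => _; last exact: sentential_insym.
exact: terminal_sentential (t0_child Ct).
Qed.

(** The values of [g] are terminal, so expanding a child removes its symbols and creates no new
    links. *)
Let Lnt_T i D l' : Lnt D l' \in labels (T i) <->
  Lnt D l' \in labels t0 /\
  ~~ ((l' == rcons l (link_index r D)) && (link_index r D < i)).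
Proof.
rewrite (Lnt_labels_lsub st0 (@sE i)); split.
  case=> C [l1 [Ct]]; rewrite /E; case: ifPn => [/andP[/eqP el _]|nE].
    rewrite el in Ct; have [_ _ /is_Sigma_Lnt gT] := t0_child Ct.
    by rewrite (negPf (gT _ _)).
  by rewrite labels_insym inE => /eqP[-> ->].
case=> Dt nE; exists D, l'; split=> //.
by rewrite /E (negPf nE) labels_insym inE.
Qed.

Let stT i : is_sentential rkN rkS (T i).
Proof. exact: sentential_lsub st0 (@sE i). Qed.

Let T0 : T 0 = t0.
Proof.
have /is_sententialP[rt0 _ _] := st0.
rewrite -[RHS](bind_id rt0); apply: eq_in_bind => -[C|C l'|s] _ //=.
by rewrite /E ltn0 andbF.
Qed.

(** Symbols of the link number [i] have index exactly [i] and are still unexpanded; no symbol of [t]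
    carries [rcons l i]. *)
Let linkedT i : i < size (ord r) ->
  linked (nth [::] (ord r) i) (rcons l i) (T i).
Proof.
move=> lti; have [_ ordr] := ordG rG.
apply/linkedP => C; apply/idP/idP => [Ci|/Lnt_T[]].
  apply/Lnt_T; rewrite (link_indexE rG lti Ci) ltnn andbF; split=> //.
  apply/(Lnt_labels_fire rG st lr); right.
  by exists (nth [::] (ord r) i); rewrite -?ordr ?mem_nth // (link_indexE rG lti Ci).
case/(Lnt_labels_fire rG st lr)=> [[Ct _]|[B Br [CB]]].
  by have := link_maximal_rcons i C lt; rewrite Ct.
by case/rcons_inj=> ei _; rewrite ei (nth_link_index rG Br CB).
Qed.

(** An old symbol whose identifier extends [rcons l i] would properly extend [l], and the children
    of [l] all have the same length. *)
Let maximalT i : link_maximal (rcons l i) (T i).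
Proof.
move=> C l' /Lnt_T[+ _] pl; case/(Lnt_labels_fire rG st lr).
  case=> Ct nl; case: nl; apply: lt Ct _.
  exact: prefix_trans (prefix_rcons _ _) pl.
case=> B Br [CB el]; move: pl; rewrite el prefixE size_rcons.
by rewrite take_oversize ?size_rcons // => /eqP.
Qed.

Let t0_E i C l' : Lnt C l' \in labels t0 ->
  ranked rk (rkN C) (at_link (rcons l i) g C l') /\
  E i.+1 C l' = bind (lsub (at_link (rcons l i) g)) (E i C l').
Proof.
move=> Ct; rewrite /E.
have [Cl|nCl] := eqVneq l' (rcons l (link_index r C)).
  rewrite Cl in Ct *; have gT := t0_child Ct.
  have rg : ranked rk (rkN C) (at_link (rcons l i) g C (rcons l (link_index r C))).
    rewrite /at_link; case: ifP => _; first by case: gT.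
    exact: (ranked_insym rk (Lnt _ _)).
  (* An index below [i] is already expanded to a terminal pattern, which the new binding fixes.
     Otherwise the symbol is still a link, expanded now exactly when its index is [i]. *)
  split=> //; rewrite ltnS leq_eqVlt andTb.
  case: ltnP => [_|lei]; first by rewrite orbT (bind_lsub_terminal _ gT).
  by rewrite bind_lsub_insym // orbF /at_link eqseq_rcons eqxx.
have nCi : l' <> rcons l i.
  move=> el; case/(Lnt_labels_fire rG st lr): Ct => [[Ct _]|[B Br [CB el']]].
    by have := link_maximal_rcons i C lt; rewrite -el Ct.
  by case/eqP: nCl.
have rg : ranked rk (rkN C) (at_link (rcons l i) g C l').
  by rewrite /at_link; move/eqP/negPf: nCi => ->; apply: (ranked_insym rk (Lnt _ _)).
split=> //; rewrite bind_lsub_insym // /at_link.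
by move/eqP/negPf: nCi => ->.
Qed.

Let TS i : i < size (ord r) ->
  T i.+1 = bind (lsub (at_link (rcons l i) g)) (T i).
Proof.
move=> lti; have /is_sententialP[rt0 _ /allP at0] := st0.
rewrite /T (bind_bind rt0); first 1 last.
- by apply: ranked_lsub => C l' /(@sE i).
- move=> a ha [C _|C l' Ca|s _]; try exact: ranked_insym.
  suff /Lnt_T[/(t0_E i)[]] : Lnt C l' \in labels (T i) by [].
  by apply: mem_labels_bind rt0 _ ha Ca; apply: covers_lsub => D l1 /(@sE i).
- apply: eq_in_bind => -[C /at0|C l' /(t0_E i)[]|s _] //.
  exact/esym/bind_lsub_Tm.
Qed.

Hypothesis gD : forall B, B \in links r ->
  forall l1 t1, is_sentential rkN rkS t1 -> linked B l1 t1 ->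
    link_maximal l1 t1 ->
  clos_refl_trans _ (step G ord) t1 (bind (lsub (at_link l1 g)) t1).

Let derives_T i : i <= size (ord r) -> clos_refl_trans _ (step G ord) t (T i).
Proof.
elim: i => [_|i IH lti].
  by rewrite T0; apply: rt_step; apply: step_fire.
apply: rt_trans (IH (ltnW lti)) _; rewrite TS //.
apply: gD (stT i) (linkedT lti) (@maximalT i).
by have [_ <-] := ordG rG; rewrite mem_nth.
Qed.

(** By associativity, firing [r] and then expanding every child is a single instantiation at [l].
    The hypothesis [gD] is the induction hypothesis to be supplied by [langA_derives]. *)
Lemma derives_instantiate : clos_refl_trans _ (step G ord) t
  (bind (lsub (at_link l (bind (nsub g) \o body r))) t).
Proof.
have /is_sententialP[rt _ /allP at_] := st.
suff -> : bind (lsub (at_link l (bind (nsub g) \o body r))) t = T (size (ord r)).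
  exact: derives_T.
rewrite /T /t0 (bind_bind rt); first 1 last.
- by apply: ranked_lsub => C l' /(sentential_fire rG lr).
- move=> a ha [C _|C l' Ca|s _]; try exact: ranked_insym.
  suff /(@sE (size (ord r)))[] : Lnt C l' \in labels t0 by [].
  apply: mem_labels_bind rt _ ha Ca.
  by apply: covers_lsub => D l1 /(sentential_fire rG lr).
apply: eq_in_bind => -[C /at_//|C l' Ct|s _]; last first.
  exact/esym/bind_lsub_Tm.
rewrite [LHS]/lsub [RHS]/comp [X in bind _ X]/lsub /fire /at_link.
have [el|nl] := eqVneq l' l; last first.
  have nE : (l' == rcons l (link_index r C)) = false.
    apply/eqP=> el; rewrite el in Ct.
    by have := link_maximal_rcons (link_index r C) C lt; rewrite Ct.
  by rewrite bind_lsub_insym /E nE //; apply: (ranked_insym rk (Lnt _ _)).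
rewrite el -(iffLR (linkedP _ _ _) lr) in Ct; have [rb _ /allP ab] := bodyP rG Ct.
(* At the last stage the bound [size (ord r)] exceeds every link index, so all children are
   expanded. *)
have ED D : Nt D \in labels (body r C) ->
    E (size (ord r)) D (rcons l (link_index r D)) = g D /\ ranked rk (rkN D) (g D).
  case/(body_link rG Ct)=> B Br DB.
  rewrite /E eqxx (link_index_lt rG Br DB); split=> //.
  by have [] := langA_map_terminal (gL Br) DB.
rewrite /= (bind_bind rb); first 1 last.
- exact: ranked_child.
- move=> [D /ED[eD rD]|D l1 /ab//|s _] b; rewrite /nsub labels_insym inE => /eqP-> /=.
    by rewrite eD.
  exact: ranked_insym.
apply: eq_in_bind => -[D /ED[eD rD]|D l1 /ab//|s _].
  by rewrite [LHS]/nsub [RHS]/comp [X in bind _ X]/nsub /child bind_lsub_insym eD.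
exact/esym/bind_lsub_Tm.
Qed.

End Instantiate.

(** The function [g] is quantified after the membership of [F], because the induction presents [F]
    through a function of its own; the two agree on [A], hence on all symbols at [l]. *)
Lemma langA_derives A F : langA G A F ->
  forall g : N -> tree symb, F = map g A ->
  forall l t, is_sentential rkN rkS t -> linked A l t -> link_maximal l t ->
  clos_refl_trans _ (step G ord) t (bind (lsub (at_link l g)) t).
Proof.
elim/langA_body_ind => r g rG gL IH g' eqg l t st lr lt.
have -> : bind (lsub (at_link l g')) t =
          bind (lsub (at_link l (bind (nsub g) \o body r))) t.
  apply: eq_in_bind => -[C|C l' Ct|s] //=; rewrite /at_link; case: eqP => // el.
  move: Ct; rewrite el -(iffLR (linkedP _ _ _) lr).
  by move/eq_in_map: (esym eqg) => eg /eg.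
by apply: derives_instantiate => // B Br; apply: IH.
Qed.

(** * From derivations to L(G) *)

(** The assignment depends on the identifier too, since one nonterminal may occur under several
    identifiers, with independently chosen values. *)
Definition instantiated t := forall g : N -> seq nat -> tree symb,
  (forall A l, A \in bigN G -> linked A l t -> langA G A (map (g^~ l) A)) ->
  langA G [:: start G] [:: bind (lsub g) t].

Definition prefix_free t :=
  forall l C, Lnt C l \in labels t -> link_maximal l t.

Definition well_linked t := forall C l, Lnt C l \in labels t ->
  exists2 A, A \in bigN G & linked A l t.

Section InvariantStep.

Variables (r : rule N Sigma) (l : seq nat) (t : tree symb).
Hypothesis rG : r \in rules G.
Hypothesis st : is_sentential rkN rkS t.
Hypothesis lr : linked (lhs r) l t.
Hypothesis pt : prefix_free t.
Hypothesis wt : well_linked t.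

Let t' := bind (lsub (fire r l)) t.

Let maximal_l : link_maximal l t.
Proof. by have [C _ /pt] := linked_mem (rule_lhs rG) lr. Qed.

(** A fired symbol with identifier [l1] would make [l1] a child of [l]; but [l1] occurs in [t],
    where children of [l] are fresh. *)
Let linked_old A l1 :
  A \in bigN G -> l1 <> l -> linked A l1 t -> linked A l1 t'.
Proof.
move=> AG nl lA; have /linkedP lA' := lA; apply/linkedP => C; rewrite lA'.
apply/idP/idP => [Ct|]; first by apply/(Lnt_labels_fire rG st lr); left.
case/(Lnt_labels_fire rG st lr) => [[]//|[B _ [_ el]]].
have [D _] := linked_mem AG lA; rewrite el => Dt.
by case/negP: (link_maximal_rcons (link_index r C) D maximal_l).
Qed.

(** Equal child identifiers have equal indices, and an index determines its link. *)
Let linked_new B D : B \in links r -> D \in B ->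
  linked B (rcons l (link_index r D)) t'.
Proof.
move=> Br DB; apply/linkedP => C; apply/idP/idP => [CB|].
  apply/(Lnt_labels_fire rG st lr); right; exists B => //; split=> //.
  have [_ ordr] := ordG rG; congr rcons.
  apply: (link_indexE rG); first exact: link_index_lt rG Br CB.
  by rewrite (nth_link_index rG Br CB).
case/(Lnt_labels_fire rG st lr) => [[]|[B' Br' [CB']]].
  by rewrite (negPf (link_maximal_rcons _ _ maximal_l)).
case/rcons_inj=> ei.
by rewrite -(nth_link_index rG Br DB) ei (nth_link_index rG Br' CB').
Qed.

Lemma well_linked_fire : well_linked t'.
Proof.
move=> C l1 /(Lnt_labels_fire rG st lr)[[/wt[A AG lA] nl]|[B Br [CB ->]]].
  by exists A => //; apply: linked_old.
by exists B; [apply: (rule_links_bigN rG)|apply: linked_new].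
Qed.

Lemma prefix_free_fire : prefix_free t'.
Proof.
move=> l1 C1 /(Lnt_labels_fire rG st lr) C1t C2 l2.
move=> /(Lnt_labels_fire rG st lr) C2t.
case: C1t => [[C1t nl1]|[B1 _ [_ ->]]]; case: C2t => [[C2t nl2]|[B2 _ [_ ->]]].
- exact: pt C1t _ _ C2t.
(* An old identifier that is a prefix of a child of [l] is either a prefix of [l], hence [l] itself
   by prefix-freeness, or the whole child identifier. *)
- rewrite prefixE; have [le1|lt1] := leqP (size l1) (size l).
    rewrite -cats1 takel_cat // -prefixE => l1l; case: nl1.
    have [C _ Ct] := linked_mem (rule_lhs rG) lr.
    by rewrite (pt C1t Ct l1l).
  by rewrite take_oversize ?size_rcons // => /eqP.
- move=> pl; case: nl2; apply: maximal_l C2t _.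
  exact: prefix_trans (prefix_rcons _ _) pl.
- by rewrite prefixE size_rcons take_oversize ?size_rcons // => /eqP.
Qed.

Lemma instantiated_fire : instantiated t -> instantiated t'.
Proof.
move=> it g gL; have /is_sententialP[rt _ /allP at_] := st.
(* The assignment pulled back to [t]: at [l] it applies the rule to the values of [g] at the
   children, elsewhere it is [g]. *)
pose g1 C l1 := if l1 == l
  then bind (nsub (fun D => g D (rcons l (link_index r D)))) (body r C)
  else g C l1.
have gT C l1 : Lnt C l1 \in labels t' -> terminal_pattern (rkN C) (g C l1).
  move=> Ct; have [A AG lA] := well_linked_fire Ct.
  apply: langA_map_terminal (gL A l1 AG lA) _.
  by rewrite (iffLR (linkedP _ _ _) lA).
have st' : is_sentential rkN rkS t' := sentential_lsub st (sentential_fire rG lr).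
have fireT a b : a \in labels t -> b \in labels (lsub (fire r l) a) ->
    b \in labels t'.
  move=> at1 ba; apply: mem_labels_bind rt _ at1 ba.
  by apply: covers_lsub => D l1 /(sentential_fire rG lr).
have rg : {in labels t', forall b, ranked rk (rk b) (lsub g b)}.
  by apply: ranked_lsub => D l1 /gT /terminal_sentential.
(* Associativity trades firing followed by [g] for the single binding [g1], so the invariant of [t]
   applies. *)
have -> : bind (lsub g) t' = bind (lsub g1) t.
  rewrite (bind_bind rt); first 1 last.
  - by apply: ranked_lsub => C l1 /(sentential_fire rG lr).
  - by move=> a ha b /(fireT _ _ ha); apply: rg.
  apply: eq_in_bind => -[C /at_//|C l1 Ct|s _]; last exact: bind_lsub_Tm.
  rewrite [RHS]/lsub [LHS]/comp [X in bind _ X]/lsub /g1 /fire /at_link.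
  have [el|nl] := eqVneq l1 l; last first.
    rewrite bind_lsub_insym //; case: (gT C l1) => //.
    by apply/(Lnt_labels_fire rG st lr); left; split=> //; apply/eqP.
  have Clhs : C \in lhs r by rewrite (iffLR (linkedP _ _ _) lr) -el.
  have [rb _ /allP ab] := bodyP rG Clhs.
  have rD D : Nt D \in labels (body r C) ->
      ranked rk (rkN D) (g D (rcons l (link_index r D))).
    case/(body_link rG Clhs)=> B Br DB; case: (gT D (rcons l (link_index r D))) => //.
    by apply/(Lnt_labels_fire rG st lr); right; exists B.
  rewrite /= (bind_bind rb); first 1 last.
  - exact: ranked_child.
  - move=> [D /rD ?|D l2 /ab//|s _] b; rewrite /nsub labels_insym inE => /eqP-> //=.
    exact: ranked_insym.
  apply: eq_in_bind => -[D /rD|D l2 /ab//|s _]; last exact: bind_lsub_Tm.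
  exact: bind_lsub_insym.
apply: it => A l1 AG lA; rewrite /g1; case: eqP => [el|nl]; last first.
  by apply: gL => //; apply: linked_old.
rewrite el in lA; rewrite -(linked_inj (rule_lhs rG) AG lr lA).
apply: langA_rule => // B Br; have BG := rule_links_bigN rG Br.
(* All members of [B] share one child identifier; the head [D] of the nonempty [B] names it. *)
case E: B (bigN_nonempty BG) => [//|D B'] _; rewrite -E.
have DB : D \in B by rewrite E inE eqxx.
have := gL B _ BG (linked_new Br DB); congr (langA _ _); apply/eq_in_map => C CB.
have [uord ordr] := ordG rG; congr (g C (rcons l _)).
apply/esym/(link_indexE rG); first exact: link_index_lt rG Br DB.
by rewrite (nth_link_index rG Br DB).
Qed.

End InvariantStep.

End Grammar.

Theorem theorem19 (N Sigma : finType) (rkN : N -> nat) (rkS : Sigma -> nat)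
    (G : mcftg rkN rkS) (ord : rule N Sigma -> seq (seq N))
    (hord : link_order G ord) (t : tree (sym N Sigma)) :
  lang G t <->
  is_tree (srk rkN rkS) (@is_Sigma N Sigma) 0 t /\
  clos_refl_trans _ (step G ord) (Node (Lnt (start G) [::]) [::]) t.
Proof.
set S0 := Node _ _.
have S0E : S0 = insym (srk rkN rkS) (Lnt (start G) [::]).
  by rewrite /insym /= start_rank.
have labS0 : labels S0 = [:: Lnt (start G) [::]] by [].
have sS0 : is_sentential rkN rkS S0 by rewrite /is_sentential /= start_rank.
have lS0 : linked [:: start G] [::] S0.
  by apply/linkedP => C; rewrite labS0 !inE (inj_eq (@Lnt_inj N Sigma [::])).
have S0P C l : Lnt C l \in labels S0 -> C = start G /\ l = [::].
  by rewrite labS0 inE => /eqP[-> ->].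
have mS0 : link_maximal [::] S0 by move=> C l /S0P[].
have bindS0 g : ranked (srk rkN rkS) 0 (g (start G) [::]) ->
    bind (lsub rkN rkS g) S0 = g (start G) [::].
  by move=> rg; rewrite S0E bind_lsub_insym // start_rank.
split=> [tL|[tT]].
  have [rt _ tT] : terminal_pattern rkN rkS (rkN (start G)) t.
    by have := langA_terminal tL (mem_head _ _); rewrite /= eqxx.
  rewrite start_rank in rt; split; first by rewrite is_tree_ranked; apply/andP.
  (* The start form has one symbol, so a constant assignment suffices, and instantiating at the
     empty identifier gives [t]. *)
  have := langA_derives hord tL (g := fun=> t) erefl sS0 lS0 mS0.
  by rewrite bindS0.
suff inv u : clos_refl_trans _ (step G ord) S0 u ->
    [/\ is_sentential rkN rkS u, prefix_free u, well_linked G u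
      & instantiated G u].
  case/inv=> _ _ _ it.
  move: tT; rewrite is_tree_ranked => /andP[rt tT].
  (* A terminal tree has no links: every assignment fixes it, [Var 0] is a dummy, and the condition
     on the assignment holds vacuously. *)
  rewrite /lang -(@bind_lsub_terminal _ _ rkN rkS (fun _ _ => Var 0) 0 t) //.
  apply: it => A l AG /(linked_mem AG)[C _].
  by rewrite (negPf (is_Sigma_Lnt _ _ tT)).
(* Steps are appended at the right end, so that the invariant passes from each form to its
   successor. *)
move/(@clos_rt_rtn1 _ _ _ _) => su; elim: u / su => [|t1 t2 + _ [s1 p1 w1 i1]].
  split=> //.
  - by move=> l C /S0P[_ ->].
  - by move=> C l /S0P[_ ->]; exists [:: start G] => //; apply: start_bigN.
  - move=> g gL; have := gL _ _ (start_bigN G) lS0 => gS.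
    rewrite bindS0 //.
    have [] := langA_map_terminal gS (mem_head _ _).
    by rewrite start_rank.
case=> _ s2 [r [l [rG lr ->]]].
have /is_sententialP[rt1 _ _] := s1; rewrite (subst_fire hord rG rt1 lr).
split.
- exact: sentential_lsub s1 (sentential_fire ord rG lr).
- exact: prefix_free_fire rG s1 lr p1.
- exact (well_linked_fire hord rG s1 lr p1 w1).
- exact (instantiated_fire hord rG s1 lr p1 w1 i1).
Qed.
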